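(* Let $F: \mathbb{R}^m \to \mathbb{R}^n$ be a bounded (possibly discontinuous) semialgebraic function. Then there exist $\mathcal{N} \in ISDnet(m,n,1)$ and $c_{\max} \ge 0$ such that $\mathrm{SANN}^{lim}(\mathcal{N}, x, c_{\max}) = F(x)$ for all $x\in\mathbb{R}^m$.
   Context: For $D \subseteq \mathbb{R}^N$, $ISD(D)$ is the smallest set of functions $D \to \mathbb{R}$ containing all restrictions of real polynomials and closed under pointwise $\min$ and $\max$; vector/matrix-valued functions are ISD if all entries are. $ISDnet(m,n,k) := ISD(\mathbb{R}^m\times\mathbb{R}^{n+k}\times\mathbb{R},\ \mathbb{R}^{(n+k)\times(n+k)}\times\mathbb{R}^{n+k})$; for $\mathcal N$ in it write $\mathcal N(x,z,s) = (M(x,z,s), b(x,z,s))$. For $c\ge 0$, $\mathrm{clamp\text{-}sol}_c(M,b) := \mathrm{clamp}(M^{-1}b,-c,c)$ if $M$ is invertible and $0$ otherwise, with clamp applied componentwise ($a_i\mapsto\min(\max(a_i,-c),c)$). $\mathrm{SANN}^{lim}(\mathcal N,x,c_{\max})$ is the vector of the first $n$ components of $z(1)$, where $z:[0,1]\to\mathbb{R}^{n+k}$ is the (exact) solution of $\dot z(s) = \mathrm{clamp\text{-}sol}_{c_{\max}}(M(x,z(s),s), b(x,z(s),s))$, $z(0)=0$. A semialgebraic function is one whose graph is a semialgebraic set. *)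

(* Defs.v *)
From HB Require Import structures.
From mathcomp Require Import all_boot all_order all_algebra.
From mathcomp Require Import all_classical all_reals all_analysis.
Set Implicit Arguments. Unset Strict Implicit. Unset Printing Implicit Defensive.
Import Order.TTheory GRing.Theory Num.Theory.
Import numFieldNormedType.Exports.
Local Open Scope classical_set_scope.
Local Open Scope ring_scope.

Section Defs.
Variable R : realType.

(* Polynomial functions R^N -> R (R^N represented by column vectors 'cV_N):
   the smallest set containing constants and coordinates, closed under + and *.
   These are exactly the functions v |-> p(v) for real polynomials p. *)
Inductive poly_fun (N : nat) : ('cV[R]_N -> R) -> Prop :=
| pf_const (c : R) : poly_fun (fun _ => c)
| pf_coord (i : 'I_N) : poly_fun (fun v => v i ord0)
| pf_add f g : poly_fun f -> poly_fun g -> poly_fun (fun v => f v + g v)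
| pf_mul f g : poly_fun f -> poly_fun g -> poly_fun (fun v => f v * g v).

Inductive isd (N : nat) : ('cV[R]_N -> R) -> Prop :=
| isd_poly f : poly_fun f -> isd f
| isd_min f g : isd f -> isd g -> isd (fun v => Num.min (f v) (g v))
| isd_max f g : isd f -> isd g -> isd (fun v => Num.max (f v) (g v)).

Inductive semialg_set (N : nat) : set 'cV[R]_N -> Prop :=
| sa_pos p : poly_fun p -> semialg_set [set v | 0 < p v]
| sa_zero p : poly_fun p -> semialg_set [set v | p v = 0]
| sa_union A B : semialg_set A -> semialg_set B -> semialg_set (A `|` B)
| sa_inter A B : semialg_set A -> semialg_set B -> semialg_set (A `&` B)
| sa_compl A : semialg_set A -> semialg_set (~` A).

Definition semialg_fun (m n : nat) (F : 'cV[R]_m -> 'cV[R]_n) : Prop :=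
  semialg_set [set v : 'cV[R]_(m + n) | F (usubmx v) = dsubmx v].

Definition net_input (m p : nat) (x : 'cV[R]_m) (z : 'cV[R]_p) (s : R)
  : 'cV[R]_(m + p + 1) := col_mx (col_mx x z) (const_mx s).

Definition isdnet (m n k : nat)
  (M : 'cV[R]_(m + (n + k) + 1) -> 'M[R]_(n + k))
  (b : 'cV[R]_(m + (n + k) + 1) -> 'cV[R]_(n + k)) : Prop :=
  (forall i j, isd (fun v => M v i j)) /\ (forall i, isd (fun v => b v i ord0)).

Definition clamp (c a : R) : R := Num.min (Num.max a (- c)) c.

Definition clamp_sol (p : nat) (c : R) (M : 'M[R]_p) (b : 'cV[R]_p) : 'cV[R]_p :=
  if M \in unitmx then map_mx (clamp c) (invmx M *m b) else 0.

Definition sann_solution (m n k : nat)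
  (M : 'cV[R]_(m + (n + k) + 1) -> 'M[R]_(n + k))
  (b : 'cV[R]_(m + (n + k) + 1) -> 'cV[R]_(n + k))
  (x : 'cV[R]_m) (cmax : R) (z : R -> 'cV[R]_(n + k)) : Prop :=
  [/\ z 0 = 0,
      {within `[0, 1]%classic, continuous z} &
      forall s : R, 0 < s < 1 ->
        is_derive s 1 z
          (clamp_sol cmax (M (net_input x (z s) s)) (b (net_input x (z s) s)))].

Definition sann_lim_eq (m n k : nat)
  (M : 'cV[R]_(m + (n + k) + 1) -> 'M[R]_(n + k))
  (b : 'cV[R]_(m + (n + k) + 1) -> 'cV[R]_(n + k))
  (x : 'cV[R]_m) (cmax : R) (y : 'cV[R]_n) : Prop :=
  (exists z, sann_solution M b x cmax z) /\
  (forall z, sann_solution M b x cmax z -> usubmx (z 1) = y).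

End Defs.

(* Main.v *)
(** A semialgebraic set has an ISD penalty [q(v, e)] which is [<= 0] for all
    small [e > 0] if [v] lies in the set, and at least [k e] for all [e > 0],
    with some [k > 0] depending on [v], if not.  Take such a [q] for the graph
    of [F], write the state as [(z, w)] with [w] real, and consider the equation
<<
      (z, w)' = (z, w) / s + (0, f / (1 - w / s)),
      f = max (0, q(x, z / s, w / s - 1), (c + 1) (1 - w / s)),
>>
    clamped at [c] and with right-hand side [0] where [w = s].  Clearing
    denominators turns it into an ISD system, singular exactly where [w = s].
    If [r > 1] is close to 1 then [f] vanishes at [(x, F x, r)], so that the
    line [s (F x, r)] is a solution.

    Conversely, along any solution the derivative of [w - s] is [-1] where
    [w = s] and nonnegative where [w < s], so [w - s] never vanishes on
    [(0, 1)].  Hence [z / s] is a constant [y].  If [w < s], or if [w > s] but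
    [y] differs from [F x], then [w' - w / s] has constant sign and is bounded
    away from 0, so [w / s] diverges logarithmically as [s] tends to 0; but
    [|w'| <= c] gives [|w / s| <= c]. *)

Require Import Defs.
From HB Require Import structures.
From mathcomp Require Import all_boot all_order all_algebra.
From mathcomp Require Import all_classical all_reals all_analysis.
From mathcomp Require Import ring lra.
Set Implicit Arguments.
Unset Strict Implicit.
Unset Printing Implicit Defensive.
Import Order.TTheory GRing.Theory Num.Theory.
Import numFieldNormedType.Exports.
Local Open Scope classical_set_scope.
Local Open Scope ring_scope.

(** * Polynomial and ISD functions *)

Section PolyFun.
Context {R : realType} {N : nat}.
Implicit Types (f p : 'cV[R]_N -> R) (v : 'cV[R]_N).

Lemma poly_funB f p : poly_fun f -> poly_fun p -> poly_fun (fun v => f v - p v).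
Proof.
move=> Pf Pp; rewrite (_ : (fun v => _) = fun v => f v + -1 * p v).
  by apply: pf_add => //; apply: pf_mul => //; exact: pf_const.
by apply/funext => v; rewrite mulN1r.
Qed.

Lemma poly_funX f d : poly_fun f -> poly_fun (fun v => f v ^+ d).
Proof.
move=> Pf; elim: d => [|d IHd]; first exact: pf_const.
rewrite (_ : (fun v => _) = fun v => f v * f v ^+ d); first exact: pf_mul.
by apply/funext => v; rewrite exprS.
Qed.

Lemma isd_polyD p f : poly_fun p -> isd f -> isd (fun v => p v + f v).
Proof.
move=> Pp; elim=> [{}f Pf|f1 f2 _ If1 _ If2|f1 f2 _ If1 _ If2].
- exact/isd_poly/pf_add.
- rewrite (_ : (fun v => _) = fun v => Num.min (p v + f1 v) (p v + f2 v)).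
    exact: isd_min.
  by apply/funext => v; rewrite addr_minr.
- rewrite (_ : (fun v => _) = fun v => Num.max (p v + f1 v) (p v + f2 v)).
    exact: isd_max.
  by apply/funext => v; rewrite addr_maxr.
Qed.

Lemma isd_polyM p f : (forall v, 0 <= p v) -> poly_fun p -> isd f ->
  isd (fun v => p v * f v).
Proof.
move=> p_ge0 Pp; elim=> [{}f Pf|f1 f2 _ If1 _ If2|f1 f2 _ If1 _ If2].
- exact/isd_poly/pf_mul.
- rewrite (_ : (fun v => _) = fun v => Num.min (p v * f1 v) (p v * f2 v)).
    exact: isd_min.
  by apply/funext => v; rewrite minr_pMr.
- rewrite (_ : (fun v => _) = fun v => Num.max (p v * f1 v) (p v * f2 v)).
    exact: isd_max.
  by apply/funext => v; rewrite maxr_pMr.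
Qed.

End PolyFun.

Section PolyMap.
Context {R : realType}.

Definition poly_map (M N : nat) (phi : 'cV[R]_M -> 'cV[R]_N) : Prop :=
  forall i, poly_fun (fun v => phi v i ord0).

Lemma poly_fun_comp M N (phi : 'cV[R]_M -> 'cV[R]_N) p :
  poly_map phi -> poly_fun p -> poly_fun (p \o phi).
Proof.
move=> Pphi; elim=> [c|i|f g _ Pf _ Pg|f g _ Pf _ Pg].
- exact: pf_const.
- exact: Pphi.
- exact: pf_add Pf Pg.
- exact: pf_mul Pf Pg.
Qed.

Lemma isd_comp M N (phi : 'cV[R]_M -> 'cV[R]_N) f :
  poly_map phi -> isd f -> isd (f \o phi).
Proof.
move=> Pphi; elim=> [p Pp|f1 f2 _ If1 _ If2|f1 f2 _ If1 _ If2].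
- exact/isd_poly/poly_fun_comp.
- exact: isd_min If1 If2.
- exact: isd_max If1 If2.
Qed.

Lemma poly_map_comp M N K
    (psi : 'cV[R]_N -> 'cV[R]_K) (phi : 'cV[R]_M -> 'cV[R]_N) :
  poly_map psi -> poly_map phi -> poly_map (psi \o phi).
Proof. by move=> Ppsi Pphi i; exact: poly_fun_comp Pphi (Ppsi i). Qed.

Lemma poly_map_usubmx M N : poly_map (@usubmx R M N 1).
Proof.
move=> i.
rewrite (_ : (fun v => _) = fun v : 'cV_(M + N) => v (lshift N i) ord0).
  exact: pf_coord.
by apply/funext => v; rewrite mxE.
Qed.

Lemma poly_map_dsubmx M N : poly_map (@dsubmx R M N 1).
Proof.
move=> i.
rewrite (_ : (fun v => _) = fun v : 'cV_(M + N) => v (rshift M i) ord0).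
  exact: pf_coord.
by apply/funext => v; rewrite mxE.
Qed.

Lemma poly_map_const_mx M N (p : 'cV[R]_M -> R) :
  poly_fun p -> poly_map (fun v => const_mx (p v) : 'cV[R]_N).
Proof.
move=> Pp i; rewrite (_ : (fun v => _) = p)//.
by apply/funext => v; rewrite mxE.
Qed.

Lemma poly_map_col_mx M N K
    (phi : 'cV[R]_M -> 'cV[R]_N) (psi : 'cV[R]_M -> 'cV[R]_K) :
  poly_map phi -> poly_map psi ->
  poly_map (fun v => col_mx (phi v) (psi v)).
Proof.
move=> Pphi Ppsi i; rewrite -(splitK i); case: (fintype.split i) => j /=.
- rewrite (_ : (fun v => _) = fun v => phi v j ord0)//.
  by apply/funext => v; rewrite col_mxEu.
- rewrite (_ : (fun v => _) = fun v => psi v j ord0)//.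
  by apply/funext => v; rewrite col_mxEd.
Qed.

End PolyMap.

(** * Penalty functions of semialgebraic sets *)

Section Penalty.
Context {R : realType} {N : nat}.
Implicit Types (A B : set 'cV[R]_N) (p : 'cV[R]_N -> R).
Implicit Types (q : 'cV[R]_(N + 1) -> R).

(* The lower bound is linear in [e] so as to survive a division by [e]. *)
Definition penalises q A : Prop :=
  (forall v, A v -> \forall e \near 0^'+, q (col_mx v (const_mx e)) <= 0) /\
  (forall v, ~ A v ->
    exists2 k, 0 < k & forall e, 0 < e -> k * e <= q (col_mx v (const_mx e))).

Definition has_penalty A : Prop := exists2 q, isd q & penalises q A.

Let param (v : 'cV[R]_(N + 1)) : R := v (rshift N ord0) ord0.

Let paramE v e : param (col_mx v (const_mx e)) = e.
Proof. by rewrite /param col_mxEd mxE. Qed.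

Let poly_param : poly_fun param.
Proof. exact: pf_coord. Qed.

Let poly_usubmx p : poly_fun p ->
  poly_fun (fun v : 'cV[R]_(N + 1) => p (usubmx v)).
Proof. exact/poly_fun_comp/poly_map_usubmx. Qed.

Lemma has_penalty_gt0 p : poly_fun p -> has_penalty [set v | 0 < p v].
Proof.
move=> Pp; exists (fun v => param v - p (usubmx v)).
  exact/isd_poly/poly_funB/poly_usubmx.
split=> v /=.
  move=> pv; near=> e; rewrite paramE col_mxKu subr_le0.
  by near: e; exact: nbhs_right_le.
move=> /negP; rewrite -leNgt => pv; exists 1 => // e e_gt0.
by rewrite paramE col_mxKu; lra.
Unshelve. all: by end_near. Qed.

Lemma has_penalty_le0 p : poly_fun p -> has_penalty [set v | p v <= 0].
Proof.
move=> Pp; exists (fun v => p (usubmx v) * param v).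
  exact/isd_poly/pf_mul/poly_param/poly_usubmx.
split=> v /=.
  by move=> pv; near=> e; rewrite paramE col_mxKu mulr_le0_ge0.
move=> /negP; rewrite -ltNge => pv; exists (p v) => // e _.
by rewrite paramE col_mxKu.
Unshelve. all: by end_near. Qed.

Lemma has_penaltyU A B :
  has_penalty A -> has_penalty B -> has_penalty (A `|` B).
Proof.
move=> [q Iq [qA qNA]] [r Ir [rB rNB]].
exists (fun v => Num.min (q v) (r v)); first exact: isd_min.
split=> v.
  move=> [/qA qv|/rB rv]; near=> e; rewrite ge_min; apply/orP.
    by left; near: e.
  by right; near: e.
move=> /not_orP[/qNA[k k_gt0 kq] /rNB[l l_gt0 lr]].
exists (Num.min k l) => [|e e_gt0]; first by rewrite lt_min k_gt0.
rewrite le_min (le_trans _ (kq e e_gt0)) ?(le_trans _ (lr e e_gt0))//;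
  by rewrite ler_pM2r// ge_min lexx ?orbT.
Unshelve. all: by end_near. Qed.

Lemma has_penaltyI A B :
  has_penalty A -> has_penalty B -> has_penalty (A `&` B).
Proof.
move=> [q Iq [qA qNA]] [r Ir [rB rNB]].
exists (fun v => Num.max (q v) (r v)); first exact: isd_max.
split=> v.
  move=> [/qA qv /rB rv]; near=> e; rewrite ge_max.
  by apply/andP; split; near: e.
move=> /not_andP[/qNA[k k_gt0 kq]|/rNB[l l_gt0 lr]].
  by exists k => // e e_gt0; rewrite le_max kq.
by exists l => // e e_gt0; rewrite le_max lr ?orbT.
Unshelve. all: by end_near. Qed.

Lemma semialg_has_penalty A : semialg_set A -> has_penalty A.
Proof.
move=> sA; suff [] : has_penalty A /\ has_penalty (~` A) by [].
elim: sA => {A} [p Pp|p Pp|A B _ [pA pNA] _ [pB pNB]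
                |A B _ [pA pNA] _ [pB pNB]|A _ []].
- split; first exact: has_penalty_gt0.
  rewrite (_ : ~` _ = [set v | p v <= 0]); first exact: has_penalty_le0.
  by apply/seteqP; split=> v /=; rewrite leNgt => /negP.
- have sq_eq0 v : (p v * p v <= 0) = (p v == 0).
    by rewrite -expr2 le_eqVlt ltNge sqr_ge0 orbF sqrf_eq0.
  split.
    rewrite (_ : [set _ | _] = [set v | p v * p v <= 0]).
      exact/has_penalty_le0/pf_mul.
    by apply/seteqP; split=> v /=; rewrite sq_eq0 => /eqP.
  rewrite (_ : ~` _ = [set v | 0 < p v * p v]).
    exact/has_penalty_gt0/pf_mul.
  by apply/seteqP; split=> v /=; rewrite ltNge sq_eq0 => /eqP.
- by split; [exact: has_penaltyU | rewrite setCU; exact: has_penaltyI].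
- by split; [exact: has_penaltyI | rewrite setCI; exact: has_penaltyU].
- by split=> //; rewrite setCK.
Qed.

End Penalty.

(** * Real functions *)

Section RealFunctions.
Context {R : realType}.
Implicit Types (f df : R -> R) (a b c k s x : R).

Lemma mean_value_inequality f df a b c : a < b ->
  (forall x, x \in `]a, b[ -> is_derive x 1 f (df x)) ->
  {within `[a, b], continuous f} ->
  (forall x, x \in `]a, b[ -> `|df x| <= c) ->
  `|f b - f a| <= c * (b - a).
Proof.
move=> ab fdf fc dfc; have [x xab ->] := MVT ab fdf fc.
have ba_gt0 : 0 < b - a by rewrite subr_gt0.
by rewrite normrM (gtr0_norm ba_gt0) ler_pM2r// dfc.
Qed.

Lemma derive_lt0_decreasing_right f x d : is_derive x 1 f d -> d < 0 ->
  exists2 e, 0 < e & forall y, x < y < x + e -> f y < f x.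
Proof.
move=> /is_derive1_caratheodory[g [fE gc <-]] gx_lt0.
have [e /= e_gt0 g_lt0] : \forall y \near x, g y < 0 by exact: cvgr_lt gc _ _.
exists e => // y xye; rewrite -subr_lt0 fE pmulr_llt0; last by lra.
by apply: g_lt0; rewrite /= ltr_distlC; lra.
Qed.

(* A zero of [f] would be followed by negative values, from which [f] could not
   decrease. *)
Lemma derive_barrier_neq0 f df a b :
  (forall x, x \in `]a, b[ -> is_derive x 1 f (df x)) ->
  (forall x, x \in `]a, b[ -> f x = 0 -> df x < 0) ->
  (forall x, x \in `]a, b[ -> f x < 0 -> 0 <= df x) ->
  forall x, x \in `]a, b[ -> f x != 0.
Proof.
move=> fdf df_lt0 df_ge0 x xab; apply/eqP => fx0.
have [e e_gt0] := derive_lt0_decreasing_right (fdf x xab) (df_lt0 x xab fx0).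
rewrite fx0 => f_lt0; move: xab; rewrite in_itv/= => /andP[ax xb].
have [t [xt et bt]] : exists t, [/\ x < t, t < x + e & t < b].
  have e_le : Num.min e (b - x) <= e by rewrite ge_min lexx.
  have b_le : Num.min e (b - x) <= b - x by rewrite ge_min lexx orbT.
  have min_gt0 : 0 < Num.min e (b - x) by rewrite lt_min e_gt0 subr_gt0.
  by exists (x + Num.min e (b - x) / 2); split; lra.
have xtS y : x <= y <= t -> y \in `]a, b[ by rewrite in_itv/= => ?; lra.
have fdf_xt y : y \in `]x, t[ -> is_derive y 1 f (df y).
  by rewrite in_itv/= => xyt; apply/fdf/xtS; lra.
have fc : {within `[x, t], continuous f}.
  apply: derivable_within_continuous => y; rewrite in_itv/= => /xtS /fdf fy.
  exact: ex_derive.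
have [y] := MVT xt fdf_xt fc; rewrite in_itv/= fx0 subr0 => xyt ftE.
have ft_lt0 : f t < 0 by apply: f_lt0; lra.
have dfy_ge0 : 0 <= df y.
  by apply: df_ge0; [apply: xtS; lra | apply: f_lt0; lra].
by move: ft_lt0; rewrite ftE ltNge mulr_ge0// subr_ge0 ltW.
Qed.

Lemma neq0_constant_sign f a b :
  {in `]a, b[, continuous f} -> (forall x, x \in `]a, b[ -> f x != 0) ->
  (forall x, x \in `]a, b[ -> f x < 0) \/ (forall x, x \in `]a, b[ -> 0 < f x).
Proof.
move=> fc f_neq0; apply: contrapT => /not_orP[].
move=> /existsNP[x /not_implyP[xab /negP]]; rewrite -leNgt => fx.
move=> /existsNP[y /not_implyP[yab /negP]]; rewrite -leNgt => fy.
have no_sign_change u v : u \in `]a, b[ -> v \in `]a, b[ -> u <= v ->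
    Num.min (f u) (f v) <= 0 <= Num.max (f u) (f v) -> False.
  move=> uab vab uv f0.
  have uvS t : t \in `[u, v] -> t \in `]a, b[.
    by move: uab vab; rewrite !in_itv/=; lra.
  have [|t /uvS/f_neq0 /eqP //] := IVT uv _ f0.
  by apply: continuous_subspace_itv => t /uvS /fc.
have [xy|/ltW yx] := leP x y.
- by apply: no_sign_change xab yab xy _; rewrite ge_min le_max fx fy orbT.
- by apply: no_sign_change yab xab yx _; rewrite ge_min le_max fx fy orbT.
Qed.

Lemma is_derive_div_id f s d : 0 < s -> is_derive s 1 f d ->
  is_derive s 1 (fun t => f t / t) ((d - f s / s) / s).
Proof.
move=> s_gt0 fd; have s_neq0 : s != 0 by rewrite gt_eqF.
have dV := is_deriveV s_neq0 (is_derive_id s (1 : R)).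
by apply: is_derive_eq (is_deriveM fd dV) _; rewrite /GRing.scale/=; field.
Qed.

Lemma ratio_constant f a b : 0 < a < b ->
  (forall s, s \in `]a, b[ -> is_derive s 1 f (f s / s)) ->
  {within `[a, b], continuous f} ->
  f a / a = f b / b.
Proof.
move=> /andP[a_gt0 ab] fd fc.
have s_gt0 s : s \in `[a, b] -> 0 < s.
  by rewrite in_itv/= => /andP[/(lt_le_trans a_gt0)].
have ratio_derive s : s \in `]a, b[ -> is_derive s 1 (fun t => f t / t) 0.
  move=> sab; have s0 := s_gt0 s (subset_itv_oo_cc sab).
  by have := is_derive_div_id s0 (fd s sab); rewrite subrr mul0r.
have inv_continuous_within : {within `[a, b], continuous (@GRing.inv R)}.
  apply: continuous_subspace_itv => s /s_gt0/lt0r_neq0.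
  exact: inv_continuous.
have ratio_continuous : {within `[a, b], continuous (fun t => f t / t)}.
  by move=> s; apply: cvgM; [exact: fc | exact: inv_continuous_within].
have [s _] := MVT ab ratio_derive ratio_continuous.
by rewrite mul0r => /subr0_eq.
Qed.

Lemma ratio_unbounded_below f df a k : 0 < a -> 0 < k ->
  (forall s, s \in `]0, a[ -> is_derive s 1 f (df s)) ->
  (forall s, s \in `]0, a[ -> f s / s + k <= df s) ->
  forall c, exists2 s, s \in `]0, a[ & f s / s < c.
Proof.
move=> a_gt0 k_gt0 fdf df_ge c.
(* [g] is nondecreasing and [ln] tends to [-oo] at 0. *)
pose g t := f t / t - k * ln t.
have dg t : t \in `]0, a[ -> is_derive t 1 g ((df t - f t / t) / t - k * t^-1).
  move=> ta; have t_gt0 : 0 < t by move: ta; rewrite in_itv/=; lra.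
  apply: is_deriveB; first exact/is_derive_div_id/fdf.
  exact/is_deriveZ/is_derive1_ln.
pose b := a / 2; pose T := (Num.max 0 (f b / b - c) + 1) / k.
have b_gt0 : 0 < b by rewrite divr_gt0.
have T_gt0 : 0 < T by rewrite divr_gt0// ltr_wpDl// le_max lexx.
pose s := b * expR (- T).
have s_gt0 : 0 < s by rewrite mulr_gt0 ?expR_gt0.
have sb : s < b by rewrite gtr_pMr// expR_lt1 oppr_lt0.
have sbS t : s <= t <= b -> t \in `]0, a[ by rewrite in_itv/= /b => ?; lra.
exists s; first by apply: sbS; rewrite lexx ltW.
have dg_sb t : t \in `]s, b[ ->
    is_derive t 1 g ((df t - f t / t) / t - k * t^-1).
  by rewrite in_itv/= => tsb; apply/dg/sbS; lra.
have gc : {within `[s, b], continuous g}.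
  apply: derivable_within_continuous => t; rewrite in_itv/= => /sbS /dg gt.
  exact: ex_derive.
have g_le : g s <= g b.
  have [t] := MVT sb dg_sb gc; rewrite in_itv/= => tsb gE.
  have t_gt0 : 0 < t by lra.
  rewrite -subr_ge0 gE mulr_ge0 ?subr_ge0 ?(ltW sb)// ler_pM2r ?invr_gt0//.
  by have := df_ge t; rewrite sbS; [move=> /(_ isT); lra | lra].
move: g_le; rewrite /g /s lnM ?posrE ?expR_gt0// expRK mulrDr mulrN -/s.
rewrite [k * T]mulrC divfK ?gt_eqF//.
have : f b / b - c <= Num.max 0 (f b / b - c) by rewrite le_max lexx orbT.
by lra.
Qed.

End RealFunctions.

Section MatrixValuedFunctions.
Context {R : realType} {m n : nat}.
Implicit Types (f : R -> 'M[R]_(m, n)) (D : 'M[R]_(m, n)) (s : R).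

Lemma is_derive_coord f s D i j :
  is_derive s 1 f D -> is_derive s 1 (fun t => f t i j) (D i j).
Proof.
move=> fD; have df : derivable f s 1 by exact: ex_derive.
apply: DeriveDef; first exact: (derivable_mxP _ _ _).1.
by rewrite -[in RHS](@derive_val _ _ _ _ _ _ _ fD) derive_mx// mxE.
Qed.

Lemma continuous_within_coord (A : set R) f i j :
  {within A, continuous f} -> {within A, continuous (fun t => f t i j)}.
Proof.
move=> fc t; apply: (@continuous_comp (subspace A) _ _ f (fun B => B i j)).
  exact: fc.
exact: coord_continuous.
Qed.

End MatrixValuedFunctions.

(** * The limiting field *)

Section Clamp.
Context {R : realType}.
Implicit Types c a r : R.

Lemma clamp_id c a : `|a| <= c -> clamp c a = a.
Proof.
by rewrite ler_norml => /andP[ca ac]; rewrite /clamp max_l// min_l.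
Qed.

Lemma clamp_ge c a r : r <= a -> r <= c -> r <= clamp c a.
Proof. by move=> ra rc; rewrite /clamp le_min le_max ra rc. Qed.

Lemma clamp_le c a r : a <= r -> - c <= r -> clamp c a <= r.
Proof. by move=> ar cr; rewrite /clamp ge_min ge_max ar cr. Qed.

Lemma norm_clamp_le c a : 0 <= c -> `|clamp c a| <= c.
Proof.
move=> c_ge0.
rewrite ler_norml /clamp le_min le_max !ge_min !lexx !orbT andbT/=.
by lra.
Qed.

End Clamp.

Section PenaltyField.
Context {R : realType} {n : nat}.
Implicit Types (u : 'cV[R]_(n + 1)) (phi : 'cV[R]_(n + 1) -> R) (c k : R).

Definition level_ord : 'I_(n + 1) := rshift n ord0.

Definition level u : R := u level_ord ord0.

(* The clause for level 1 is the value of [clamp_sol] at a singular matrix. *)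
Definition penalty_field c phi u : 'cV[R]_(n + 1) :=
  if level u == 1 then 0
  else map_mx (clamp c) (u + phi u / (1 - level u) *: delta_mx level_ord ord0).

Lemma level_col_mx (y : 'cV[R]_n) (r : R) : level (col_mx y (const_mx r)) = r.
Proof. by rewrite /level col_mxEd mxE. Qed.

Lemma levelZ s u : level (s *: u) = s * level u.
Proof. by rewrite /level mxE. Qed.

Lemma penalty_field_level1 c phi u i : level u = 1 ->
  penalty_field c phi u i ord0 = 0.
Proof. by move=> /eqP u1; rewrite /penalty_field u1 mxE. Qed.

Lemma level_penalty_field c phi u : level u != 1 ->
  level (penalty_field c phi u) = clamp c (level u + phi u / (1 - level u)).
Proof.
by move=> /negbTE u1; rewrite /penalty_field u1 /level !mxE !eqxx mulr1.
Qed.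

Lemma penalty_field_lshift c phi u i : level u != 1 ->
  penalty_field c phi u (lshift 1 i) ord0 = clamp c (u (lshift 1 i) ord0).
Proof.
by move=> /negbTE u1; rewrite /penalty_field u1 !mxE eq_lrshift mulr0 addr0.
Qed.

Lemma norm_penalty_field_le c phi u i : 0 <= c ->
  `|penalty_field c phi u i ord0| <= c.
Proof.
move=> c_ge0; rewrite /penalty_field; case: ifP => _; rewrite mxE ?normr0//.
exact: norm_clamp_le.
Qed.

Lemma penalty_field_col_mx c phi (y : 'cV[R]_n) (r : R) :
  (forall i, `|y i ord0| <= c) -> `|r| <= c -> r != 1 ->
  phi (col_mx y (const_mx r)) = 0 ->
  penalty_field c phi (col_mx y (const_mx r)) = col_mx y (const_mx r).
Proof.
move=> yc rc /negbTE r1 phi0.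
rewrite /penalty_field level_col_mx r1 phi0 mul0r scale0r addr0 map_col_mx.
by congr col_mx; apply/matrixP => i j; rewrite !mxE ?ord1 clamp_id.
Qed.

Lemma level_penalty_field_ge c phi u : 1 <= c -> - c <= level u < 1 ->
  (c + 1) * (1 - level u) <= phi u ->
  Num.max 1 (level u + (c - 1)) <= level (penalty_field c phi u).
Proof.
move=> c_ge1 /andP[cu u1] phi_ge; rewrite level_penalty_field ?lt_eqF//.
have push_ge : c + 1 <= phi u / (1 - level u) by rewrite ler_pdivlMr ?subr_gt0.
by rewrite ge_max; apply/andP; split; apply: clamp_ge; lra.
Qed.

Lemma level_penalty_field_le c k phi u : 0 <= c -> 1 < level u ->
  k * (level u - 1) <= phi u ->
  level (penalty_field c phi u) <= level u - Num.min 1 k.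
Proof.
move=> c_ge0 u1 phi_ge; rewrite level_penalty_field ?gt_eqF//.
have push_ge : k <= phi u / (level u - 1) by rewrite ler_pdivlMr ?subr_gt0.
rewrite -[1 - level u]opprB invrN mulrN.
have min_le1 : Num.min 1 k <= 1 by rewrite ge_min lexx.
have min_lek : Num.min 1 k <= k by rewrite ge_min lexx orbT.
by apply: clamp_le; lra.
Qed.

End PenaltyField.

Arguments level_ord n : clear implicits.

Section HomogeneousSolution.
Context {R : realType} {p : nat}.
Implicit Types (V : 'cV[R]_p -> 'cV[R]_p) (z : R -> 'cV[R]_p).

Definition rate z (s : R) : 'cV[R]_p := s^-1 *: z s.

Definition homogeneous_solution V z : Prop :=
  [/\ z 0 = 0, {within `[0, 1], continuous z} &
      forall s : R, 0 < s < 1 -> is_derive s 1 z (V (rate z s))].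

Lemma homogeneous_solution_line V (C : 'cV[R]_p) : V C = C ->
  homogeneous_solution V (fun s => s *: C).
Proof.
move=> VC; split=> [||s /andP[s_gt0 _]]; first exact: scale0r.
  by apply: continuous_subspaceT => s; exact: scalel_continuous.
rewrite /rate scalerA mulVf ?gt_eqF// scale1r VC.
have dC := is_diff_scalel s C.
apply: DeriveDef; first exact/diff_derivable/ex_diff.
by rewrite deriveE ?diff_val ?scale1r//; exact: ex_diff.
Qed.

End HomogeneousSolution.

Section PenaltyFlow.
Context {R : realType} {n : nat}.
Variables (c : R) (phi : 'cV[R]_(n + 1) -> R) (z : R -> 'cV[R]_(n + 1)).
Hypothesis c_gt1 : 1 < c.
Hypothesis phi_ge : forall u, (c + 1) * (1 - level u) <= phi u.
Hypothesis z_sol : homogeneous_solution (penalty_field c phi) z.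
Implicit Types (i : 'I_(n + 1)) (s : R).

Let c_ge0 : 0 <= c. Proof. exact: le_trans ler01 (ltW c_gt1). Qed.

Let time_gt0 s : s \in `]0, 1[ -> 0 < s.
Proof. by rewrite in_itv/= => /andP[]. Qed.

Let speed s : 'cV[R]_(n + 1) := penalty_field c phi (rate z s).

Let rateE s i : rate z s i ord0 = z s i ord0 / s.
Proof. by rewrite mxE mulrC. Qed.

Let z_derive i s : s \in `]0, 1[ ->
  is_derive s 1 (fun t => z t i ord0) (speed s i ord0).
Proof.
by case: z_sol => _ _ dz; rewrite in_itv/= => /dz; exact: is_derive_coord.
Qed.

Let z_continuous i : {within `[0, 1], continuous (fun t => z t i ord0)}.
Proof. by case: z_sol => _ zc _; exact: continuous_within_coord. Qed.

Lemma norm_flow_rate_le s i : s \in `]0, 1[ -> `|rate z s i ord0| <= c.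
Proof.
rewrite in_itv/= => /andP[s_gt0 s_lt1].
rewrite rateE normrM normfV (gtr0_norm s_gt0) ler_pdivrMr//.
have [z0 _ _] := z_sol.
have := @mean_value_inequality R (fun t => z t i ord0)
  (fun t => speed t i ord0) 0 s c s_gt0.
rewrite z0 mxE !subr0; apply.
- by move=> t; rewrite in_itv/= => ts; apply: z_derive; rewrite in_itv/=; lra.
- apply: continuous_subspaceW (@z_continuous i) => t /=.
  by rewrite !in_itv/=; lra.
- by move=> t _; exact: norm_penalty_field_le.
Qed.

Let speed_ge s : s \in `]0, 1[ -> level (rate z s) < 1 ->
  Num.max 1 (level (rate z s) + (c - 1)) <= level (speed s).
Proof.
move=> s01 rate_lt1.
apply: level_penalty_field_ge; [exact: ltW | rewrite rate_lt1 andbT | by []].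
by have := norm_flow_rate_le (level_ord n) s01; rewrite ler_norml => /andP[].
Qed.

Let gap s : R := level (z s) - s.

Let gapE s : s \in `]0, 1[ -> gap s = s * (level (rate z s) - 1).
Proof.
move=> /time_gt0 s_gt0.
by rewrite /gap levelZ mulrBr mulr1 mulVKf ?gt_eqF.
Qed.

Let gap_derive s : s \in `]0, 1[ -> is_derive s 1 gap (level (speed s) - 1).
Proof.
by move=> s01; exact: is_deriveB (z_derive _ s01) (is_derive_id s (1 : R)).
Qed.

Let gap_neq0 s : s \in `]0, 1[ -> gap s != 0.
Proof.
apply: derive_barrier_neq0 gap_derive _ _ s => s s01.
  move=> /eqP; rewrite gapE// mulf_eq0 gt_eqF ?time_gt0//= subr_eq0.
  move=> /eqP rate1.
  by rewrite /level penalty_field_level1// sub0r oppr_lt0.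
rewrite gapE// pmulr_rlt0 ?time_gt0// subr_lt0 => /(speed_ge s01).
by rewrite ge_max subr_ge0 => /andP[].
Qed.

Lemma flow_level_neq1 s : s \in `]0, 1[ -> level (rate z s) != 1.
Proof.
move=> s01; have := gap_neq0 s01.
by rewrite gapE// mulf_eq0 subr_eq0 => /norP[].
Qed.

Lemma flow_level_dichotomy :
  (forall s, s \in `]0, 1[ -> level (rate z s) < 1) \/
  (forall s, s \in `]0, 1[ -> 1 < level (rate z s)).
Proof.
have gap_continuous : {in `]0, 1[, continuous gap}.
  move=> s /gap_derive gs; apply: differentiable_continuous.
  exact/derivable1_diffP/ex_derive.
have gap_sign s : s \in `]0, 1[ ->
    (gap s < 0) = (level (rate z s) < 1) /\
    (0 < gap s) = (1 < level (rate z s)).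
  move=> s01; have s_gt0 := time_gt0 s01.
  by rewrite gapE// pmulr_rlt0// pmulr_rgt0// subr_lt0 subr_gt0.
have [gap_lt0|gap_gt0] := neq0_constant_sign gap_continuous gap_neq0.
- by left=> s s01; have [<- _] := gap_sign s s01; exact: gap_lt0.
- by right=> s s01; have [_ <-] := gap_sign s s01; exact: gap_gt0.
Qed.

Lemma flow_usubmx_constant s : s \in `]0, 1[ ->
  usubmx (rate z s) = usubmx (z 1).
Proof.
move=> s01; apply/matrixP => i j; rewrite !mxE ord1 mulrC.
rewrite -[RHS]divr1.
apply: (ratio_constant (f := fun t => z t (lshift 1 i) ord0)).
- by move: s01; rewrite in_itv.
- move=> t; rewrite in_itv/= => st.
  have t01 : t \in `]0, 1[ by move: s01; rewrite !in_itv/=; lra.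
  have := z_derive (lshift 1 i) t01.
  rewrite /speed penalty_field_lshift ?flow_level_neq1//.
  by rewrite clamp_id ?norm_flow_rate_le// rateE.
- apply: continuous_subspaceW (@z_continuous (lshift 1 i)) => t /=.
  by move: s01; rewrite !in_itv/=; lra.
Qed.

Lemma flow_level_gt1 s : s \in `]0, 1[ -> 1 < level (rate z s).
Proof.
case: flow_level_dichotomy => [rate_lt1|]; last exact.
have c1_gt0 : 0 < c - 1 by rewrite subr_gt0.
have dw := z_derive (level_ord n).
have [|t t01 rate_t] := ratio_unbounded_below ltr01 c1_gt0 dw _ (- c).
  move=> t t01; have := speed_ge t01 (rate_lt1 t t01).
  by rewrite ge_max => /andP[_]; rewrite [level (rate z t)]rateE.
have := norm_flow_rate_le (level_ord n) t01.
by rewrite rateE ler_norml => /andP[]; lra.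
Qed.

Lemma flow_endpoint_penalty_lt k : 0 < k ->
  exists2 r, 1 < r & phi (col_mx (usubmx (z 1)) (const_mx r)) < k * (r - 1).
Proof.
move=> k_gt0; apply: contrapT => no_r.
have rate_split s : s \in `]0, 1[ ->
    rate z s = col_mx (usubmx (z 1)) (const_mx (level (rate z s))).
  move=> s01; rewrite -(flow_usubmx_constant s01) -[LHS]vsubmxK; congr col_mx.
  by apply/matrixP => i j; rewrite mxE [RHS]mxE (ord1 i) (ord1 j).
have phi_rate s : s \in `]0, 1[ -> k * (level (rate z s) - 1) <= phi (rate z s).
  move=> s01; rewrite leNgt [in phi _]rate_split//.
  apply/negP => phi_lt; apply: no_r.
  by exists (level (rate z s)); first exact: flow_level_gt1.
have min_gt0 : 0 < Num.min 1 k by rewrite lt_min ltr01.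
have dzN s (s01 : s \in `]0, 1[) := is_deriveN (z_derive (level_ord n) s01).
have [|t t01] := ratio_unbounded_below ltr01 min_gt0 dzN _ (- c).
  move=> s s01; rewrite mulNr -rateE lerNr opprD opprK.
  by apply: level_penalty_field_le; rewrite ?flow_level_gt1 ?phi_rate.
have := norm_flow_rate_le (level_ord n) t01.
by rewrite mulNr -rateE ler_norml => /andP[_]; lra.
Qed.

End PenaltyFlow.

Section RatePenalty.
Context {R : realType} {m n : nat}.
Variables (c : R) (q : 'cV[R]_(m + n + 1) -> R).

Definition excess (v : 'cV[R]_(m + (n + 1))) : R := level (dsubmx v) - 1.

Definition excess_input (v : 'cV[R]_(m + (n + 1))) : 'cV[R]_(m + n + 1) :=
  col_mx (col_mx (usubmx v) (usubmx (dsubmx v))) (const_mx (excess v)).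

Definition rate_penalty (v : 'cV[R]_(m + (n + 1))) : R :=
  Num.max (Num.max 0 (q (excess_input v))) (- (c + 1) * excess v).

Lemma rate_penaltyE x y r :
  rate_penalty (col_mx x (col_mx y (const_mx r))) =
  Num.max (Num.max 0 (q (col_mx (col_mx x y) (const_mx (r - 1)))))
          (- (c + 1) * (r - 1)).
Proof.
rewrite /rate_penalty /excess_input /excess.
by rewrite !(col_mxKu, col_mxKd) level_col_mx.
Qed.

Lemma rate_penalty_ge x u :
  (c + 1) * (1 - level u) <= rate_penalty (col_mx x u).
Proof. by rewrite le_max /excess col_mxKd mulNr -mulrN opprB lexx orbT. Qed.

Lemma isd_rate_penalty : isd q -> isd rate_penalty.
Proof.
move=> Iq; have Pexcess : poly_fun excess.
  apply: poly_funB; last exact: pf_const.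
  exact: (@poly_map_dsubmx _ _ _ (level_ord n)).
apply: isd_max; last exact/isd_poly/pf_mul/Pexcess/pf_const.
apply: isd_max; first exact/isd_poly/pf_const.
apply: isd_comp Iq; apply/poly_map_col_mx/poly_map_const_mx/Pexcess.
apply: poly_map_col_mx; first exact: poly_map_usubmx.
exact: poly_map_comp (@poly_map_usubmx _ _ _) (@poly_map_dsubmx _ _ _).
Qed.

End RatePenalty.

Lemma semialg_fun_penalty (R : realType) (m n : nat)
    (F : 'cV[R]_m -> 'cV[R]_n) (c : R) :
  semialg_fun F -> 0 <= c ->
  exists f : 'cV[R]_(m + (n + 1)) -> R,
  [/\ isd f,
      forall x u, (c + 1) * (1 - level u) <= f (col_mx x u),
      forall x, exists2 r, 1 < r <= 2 &
        f (col_mx x (col_mx (F x) (const_mx r))) = 0 &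
      forall x y, F x <> y -> exists2 k, 0 < k &
        forall r, 1 < r -> k * (r - 1) <= f (col_mx x (col_mx y (const_mx r)))].
Proof.
move=> /semialg_has_penalty[q Iq [q_le0 q_ge]] c_ge0.
exists (rate_penalty c q); split=> [|x u|x|x y Fxy].
- exact: isd_rate_penalty.
- exact: rate_penalty_ge.
- have /q_le0 q_le : F (usubmx (col_mx x (F x))) = dsubmx (col_mx x (F x)).
    by rewrite col_mxKu col_mxKd.
  near (0 : R)^'+ => e; have e_gt0 : 0 < e by [].
  exists (1 + e).
    rewrite ltrDl e_gt0/= -[leRHS]/(1 + 1) lerD2l.
    by near: e; exact: nbhs_right_le.
  have qe : q (col_mx (col_mx x (F x)) (const_mx e)) <= 0 by near: e.
  rewrite rate_penaltyE addrAC subrr add0r.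
  by rewrite (max_l qe) max_l// mulNr oppr_le0 mulr_ge0 ?addr_ge0// ltW.
- have [|k k_gt0 qk] := q_ge (col_mx x y).
    by rewrite /= col_mxKu col_mxKd.
  exists k => // r r_gt1; rewrite rate_penaltyE 2!le_max qk ?orbT//.
  by rewrite subr_gt0.
Unshelve. all: by end_near. Qed.

(** * The network *)

Section Homogenisation.
Context {R : realType} {m p : nat}.
Implicit Types (q : 'cV[R]_(m + p + 1) -> R) (f : 'cV[R]_(m + p) -> R).
Implicit Types d e : nat.

Definition input_time (v : 'cV[R]_(m + p + 1)) : R :=
  v (rshift (m + p) ord0) ord0.

Definition input_state (v : 'cV[R]_(m + p + 1)) : 'cV[R]_p := dsubmx (usubmx v).

Lemma input_timeE x u s : input_time (net_input x u s) = s.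
Proof. by rewrite /input_time col_mxEd mxE. Qed.

Lemma input_stateE x u s : input_state (net_input x u s) = u.
Proof. by rewrite /input_state col_mxKu col_mxKd. Qed.

Lemma poly_input_time : poly_fun input_time.
Proof. exact: pf_coord. Qed.

Lemma poly_input_state : poly_map input_state.
Proof.
exact: poly_map_comp (@poly_map_dsubmx _ _ _) (@poly_map_usubmx _ _ _).
Qed.

(* The exponent is even so that multiplication by the power of [s] commutes
   with [min] and [max] for negative [s] too. *)
Definition homogenises d q f : Prop :=
  forall x (u : 'cV[R]_p) s, 0 < s ->
    q (net_input x u s) = s ^+ d.*2 * f (col_mx x (s^-1 *: u)).

Let exp_double_ge0 d (s : R) : 0 <= s ^+ d.*2.
Proof. by rewrite exprn_even_ge0 ?odd_double. Qed.

Let scale d v : R := input_time v ^+ d.*2.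

Let poly_scale d : poly_fun (scale d).
Proof. exact/poly_funX/poly_input_time. Qed.

Lemma homogenisesM d e q f :
  homogenises d q f -> homogenises (e + d) (fun v => scale e v * q v) f.
Proof.
move=> qf x u s s_gt0.
by rewrite qf// /scale input_timeE mulrA -exprD -doubleD.
Qed.

Lemma poly_homogenise f : poly_fun f ->
  exists d q, poly_fun q /\ homogenises d q f.
Proof.
elim=> [c|i|f1 f2 _ [d1 [q1 [Pq1 q1f1]]] _ [d2 [q2 [Pq2 q2f2]]]
           |f1 f2 _ [d1 [q1 [Pq1 q1f1]]] _ [d2 [q2 [Pq2 q2f2]]]].
- exists 0%N, (fun=> c); split=> [|x u s _]; first exact: pf_const.
  by rewrite mul1r.
- rewrite -(splitK i); case: (fintype.split i) => j /=.
    exists 0%N, (fun v => v (lshift 1 (lshift p j)) ord0).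
    split=> [|x u s _]; first exact: pf_coord.
    by rewrite /net_input !col_mxEu mul1r.
  exists 1%N, (fun v => input_time v * input_state v j ord0).
  split=> [|x u s s_gt0].
    exact: pf_mul poly_input_time (poly_input_state j).
  rewrite input_timeE input_stateE col_mxEd mxE; field.
  by rewrite gt_eqF.
- exists (d1 + d2)%N, (fun v => scale d2 v * q1 v + scale d1 v * q2 v).
  split=> [|x u s s_gt0]; first by apply: pf_add; exact: pf_mul.
  by rewrite mulrDr (homogenisesM d2 q1f1)// (homogenisesM d1 q2f2)// addnC.
- exists (d1 + d2)%N, (fun v => q1 v * q2 v).
  split=> [|x u s s_gt0]; first exact: pf_mul.
  by rewrite q1f1// q2f2// doubleD exprD mulrACA.
Qed.

Lemma isd_homogenise f : isd f -> exists d q, isd q /\ homogenises d q f.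
Proof.
have Iscale d q : isd q -> isd (fun v => scale d v * q v).
  by move=> Iq; apply: isd_polyM (poly_scale d) Iq => v; exact: exp_double_ge0.
elim=> [{}f /poly_homogenise[d [q [Pq qf]]]
       |f1 f2 _ [d1 [q1 [Iq1 q1f1]]] _ [d2 [q2 [Iq2 q2f2]]]
       |f1 f2 _ [d1 [q1 [Iq1 q1f1]]] _ [d2 [q2 [Iq2 q2f2]]]].
- by exists d, q; split=> //; exact: isd_poly.
- exists (d1 + d2)%N,
    (fun v => Num.min (scale d2 v * q1 v) (scale d1 v * q2 v)).
  split=> [|x u s s_gt0]; first by apply: isd_min; exact: Iscale.
  by rewrite (homogenisesM d2 q1f1)// (homogenisesM d1 q2f2)// addnC minr_pMr.
- exists (d1 + d2)%N,
    (fun v => Num.max (scale d2 v * q1 v) (scale d1 v * q2 v)).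
  split=> [|x u s s_gt0]; first by apply: isd_max; exact: Iscale.
  by rewrite (homogenisesM d2 q1f1)// (homogenisesM d1 q2f2)// addnC maxr_pMr.
Qed.

End Homogenisation.

Section Network.
Context {R : realType} {m n : nat}.
Variables (d : nat) (q : 'cV[R]_(m + (n + 1) + 1) -> R).
Implicit Types v : 'cV[R]_(m + (n + 1) + 1).

Definition gate v : R :=
  input_time v ^+ d.*2 * (input_time v - level (input_state v)).

(* With [q] equal to [s ^+ d.*2 * f], the factor [s * gate] clears the
   denominators of the penalty field of [f] at [u / s]. *)
Definition net_mx v : 'M[R]_(n + 1) := (input_time v * gate v)%:M.

Definition net_rhs v : 'cV[R]_(n + 1) :=
  gate v *: input_state v +
  (input_time v ^+ 2 * q v) *: delta_mx (level_ord n) ord0.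

Lemma isdnet_net : isd q -> isdnet net_mx net_rhs.
Proof.
move=> Iq; have Pt := @poly_input_time R m (n + 1).
have Pgate : poly_fun gate.
  apply: pf_mul; first exact: poly_funX.
  exact: poly_funB (poly_input_state _).
split=> [i j|i].
  rewrite (_ : (fun v => _) = fun v => input_time v * gate v * (i == j)%:R).
    by apply/isd_poly/pf_mul; [exact: pf_mul | exact: pf_const].
  by apply/funext => v; rewrite mxE mulr_natr.
rewrite (_ : (fun v => _) = fun v => gate v * input_state v i ord0 +
    input_time v ^+ 2 * (i == level_ord n)%:R * q v).
  apply: isd_polyD; first exact: pf_mul (poly_input_state i).
  apply: isd_polyM => // [v|]; first by rewrite mulr_ge0 ?sqr_ge0.
  by apply: pf_mul; [exact: poly_funX | exact: pf_const].
by apply/funext => v; rewrite /input_state !mxE eqxx andbT [_ * q v * _]mulrAC.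
Qed.

Lemma clamp_sol_net c f x u s : homogenises d q f -> 0 < s ->
  clamp_sol c (net_mx (net_input x u s)) (net_rhs (net_input x u s)) =
  penalty_field c (fun r => f (col_mx x r)) (s^-1 *: u).
Proof.
move=> qf s_gt0; have s_neq0 : s != 0 by rewrite gt_eqF.
rewrite /clamp_sol /net_mx /net_rhs /gate input_timeE input_stateE qf//.
set t := s ^+ d.*2; have t_neq0 : t != 0 by rewrite expf_neq0.
have gap_eq0 : (s - level u == 0) = (level (s^-1 *: u) == 1).
  rewrite levelZ -[RHS](inj_eq (mulfI s_neq0)) mulVKf// mulr1.
  by rewrite subr_eq0 eq_sym.
have pos_dim : (0 < n + 1)%N by rewrite addn1.
rewrite unitmxE det_scalar unitfE expf_eq0 pos_dim/= !mulf_eq0.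
rewrite (negbTE s_neq0) (negbTE t_neq0)/= /penalty_field -gap_eq0.
case: ifPn => gap_neq0; last by rewrite (negbNE gap_neq0).
rewrite (negbTE gap_neq0) invmx_scalar mul_scalar_mx scalerDr !scalerA levelZ.
have -> : 1 - s^-1 * level u = (s - level u) / s by field.
by congr (map_mx _ (_ *: _ + _ *: _)); field; rewrite ?s_neq0 ?t_neq0 ?gap_neq0.
Qed.

Lemma sann_solution_net c f x z : homogenises d q f ->
  sann_solution net_mx net_rhs x c z <->
  homogeneous_solution (penalty_field c (fun r => f (col_mx x r))) z.
Proof.
move=> qf; split=> -[z0 zc dz]; split=> // s s01;
  by have := dz s s01; rewrite (clamp_sol_net _ _ _ qf)//; case/andP: s01.
Qed.

End Network.

Lemma bounded_fun_coord (R : realType) (T : Type) (n : nat)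
    (F : T -> 'cV[R]_n) :
  bounded_fun F -> \forall c \near +oo, forall x i, `|F x i ord0| <= c.
Proof.
move=> boundedF; near=> c => x i; apply: (@le_trans _ _ `|F x|).
  rewrite [leRHS]/Num.Def.normr/= mx_normrE.
  exact: (le_bigmax _ (fun ij => `|F x ij.1 ij.2|) (i, ord0)).
have F_le y : [set: T] y -> `|F y| <= c by move: y; near: c; exact: boundedF.
exact: F_le.
Unshelve. all: by end_near. Qed.

Theorem mainTheorem6 (R : realType) (m n : nat) (F : 'cV[R]_m -> 'cV[R]_n) :
  semialg_fun F -> bounded_fun F ->
  exists (M : 'cV[R]_(m + (n + 1) + 1) -> 'M[R]_(n + 1))
         (b : 'cV[R]_(m + (n + 1) + 1) -> 'cV[R]_(n + 1)) (cmax : R),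
    [/\ isdnet M b, 0 <= cmax &
        forall x : 'cV[R]_m, sann_lim_eq M b x cmax (F x)].
Proof.
move=> semialgF /bounded_fun_coord F_bounded.
near (+oo : set_system R) => c.
have F_le x i : `|F x i ord0| <= c by move: x i; near: c.
have c_ge2 : 2 <= c by near: c; exact: nbhs_pinfty_ge.
have c_ge0 : 0 <= c by lra.
have [f [If f_low f_graph f_off]] := semialg_fun_penalty semialgF c_ge0.
have [d [q [Iq qf]]] := isd_homogenise If.
exists (net_mx d), (net_rhs d q), c.
split=> [||x]; [exact: isdnet_net | by [] |].
split=> [|z /(sann_solution_net _ _ _ qf) z_sol].
  have [r r12 fr0] := f_graph x.
  exists (fun s => s *: col_mx (F x) (const_mx r)).
  apply/(sann_solution_net _ _ _ qf)/homogeneous_solution_line.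
  by apply: penalty_field_col_mx fr0 => //; [rewrite ger0_norm; lra | lra].
apply: contrapT => /nesym/f_off[k k_gt0 fk].
have c_gt1 : 1 < c by lra.
have [r r_gt1] := flow_endpoint_penalty_lt c_gt1 (f_low x) z_sol k_gt0.
by rewrite ltNge fk.
Unshelve. all: by end_near. Qed.
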